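(* Let $A\in\mathbb{M}_n(\mathbb{C})$ with $k=\mathrm{ind}(A)$. If $A^k$ and $A^{k+1}$ are partial isometries, then the core EP inverse $A^{\mathrm{cep}}$ is a partial isometry.
   Context: $\mathbb{M}_n(\mathbb{C})$ is the algebra of $n\times n$ complex matrices; $^*$ is conjugate transpose; $\mathcal{R}(\cdot)$ is column space; $A^0=I$. A matrix $B$ is a partial isometry if its Moore-Penrose inverse satisfies $B^\dagger=B^*$, equivalently $BB^*B=B$. The index $\mathrm{ind}(A)$ is the smallest integer $k\ge 0$ with $\mathrm{rank}(A^k)=\mathrm{rank}(A^{k+1})$. The core EP inverse of $A$, denoted here $A^{\mathrm{cep}}$, is the unique $X\in\mathbb{M}_n(\mathbb{C})$ with $XAX=X$ and $\mathcal{R}(X)=\mathcal{R}(A^k)=\mathcal{R}(X^* )$, where $k=\mathrm{ind}(A)$. *)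

(* Defs.v *)
From HB Require Import structures.
From mathcomp Require Import all_boot all_order all_algebra.
From mathcomp Require Export complex.
From mathcomp Require Export reals.
Set Implicit Arguments.
Unset Strict Implicit.
Unset Printing Implicit Defensive.

Import Order.TTheory GRing.Theory Num.Theory.
Local Open Scope ring_scope.
Local Open Scope sesquilinear_scope.

(* [Num.conj] on R[i] is the usual complex conjugation, so that [B ^t*] is the
   conjugate transpose in all that follows. *)
Lemma conj_complexE (R : realType) (a b : R) : (a +i* b)%C^* = (a -i* b)%C.
Proof. by []. Qed.

Section Index.
Variables (F : fieldType) (n : nat).
Implicit Type A : 'M[F]_n.

Lemma mxindex_exists A : exists k, \rank (A ^+ k) == \rank (A ^+ k.+1).
Proof.
have [/existsP[k rk]|/existsPn nrk] :=
  boolP [exists k : 'I_n.+1, \rank (A ^+ k) == \rank (A ^+ k.+1)].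
  by exists k.
have le_rk k : (k <= n.+1)%N -> (\rank (A ^+ k) + k <= n)%N.
  elim: k => [|k IHk] lek; first by rewrite addn0 rank_leq_row.
  have := nrk (Ordinal lek); rewrite /= => neq.
  have lt_rk : (\rank (A ^+ k.+1) < \rank (A ^+ k))%N.
    by rewrite ltn_neqAle eq_sym neq exprS mxrankM_maxr.
  by rewrite addnS (leq_trans _ (IHk (ltnW lek))) // ltn_add2r.
by have := le_rk n.+1 (leqnn _); rewrite addnS ltnNge leq_addl.
Qed.

Definition mxindex A : nat := ex_minn (mxindex_exists A).

Lemma mxindexP A : \rank (A ^+ mxindex A) = \rank (A ^+ (mxindex A).+1).
Proof. by rewrite /mxindex; case: ex_minnP => k /eqP. Qed.

Lemma mxindex_min A k :
  \rank (A ^+ k) = \rank (A ^+ k.+1) -> (mxindex A <= k)%N.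
Proof. by move=> rk; rewrite /mxindex; case: ex_minnP => j _; apply; apply/eqP. Qed.

End Index.

(* MathComp represents subspaces by row spaces: the column space of X is the
   row space of its transpose. *)
Definition eq_colspace (F : fieldType) (n p q : nat)
    (X : 'M[F]_(n, p)) (Y : 'M[F]_(n, q)) : bool := (X^T == Y^T)%MS.

Lemma eq_colspaceP (F : fieldType) (n p q : nat)
    (X : 'M[F]_(n, p)) (Y : 'M[F]_(n, q)) :
  reflect (forall y : 'cV[F]_n, (exists u, y = X *m u) <-> (exists v, y = Y *m v))
          (eq_colspace X Y).
Proof.
have sub r (Z : 'M[F]_(n, r)) (y : 'cV_n) :
    (y^T <= Z^T)%MS <-> exists u, y = Z *m u.
  split=> [/submxP[D yE]|[u ->]]; last by rewrite trmx_mul submxMl.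
  by exists D^T; rewrite -[y]trmxK yE trmx_mul trmxK.
have le_of r s (Z : 'M[F]_(n, r)) (W : 'M[F]_(n, s)) :
    (forall y : 'cV_n, (exists u, y = Z *m u) -> exists v, y = W *m v) ->
    (Z^T <= W^T)%MS.
  move=> h; apply/row_subP => i; rewrite -tr_col; apply/sub/h.
  by exists (delta_mx i 0); rewrite colE.
apply: (iffP andP) => [[XY YX] y|h].
  by split=> /sub yle; apply/sub; apply: submx_trans yle _.
by split; apply: le_of => y /h.
Qed.

Section CoreEP.
Variable C : numClosedFieldType.

(* [X] is the Moore-Penrose inverse of [B]. *)
Definition is_mpinv (m n : nat) (B : 'M[C]_(m, n)) (X : 'M[C]_(n, m)) : Prop :=
  [/\ B *m X *m B = B, X *m B *m X = X,
      (B *m X)^t* = B *m X & (X *m B)^t* = X *m B].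

Definition partial_isometry (m n : nat) (B : 'M[C]_(m, n)) : Prop :=
  is_mpinv B (B^t*).

Lemma adjmxM (m n p : nat) (A : 'M[C]_(m, n)) (B : 'M[C]_(n, p)) :
  (A *m B)^t* = B^t* *m A^t*.
Proof. by rewrite trmx_mul map_mxM. Qed.

Lemma mpinv_unique (m n : nat) (B : 'M[C]_(m, n)) (X Y : 'M[C]_(n, m)) :
  is_mpinv B X -> is_mpinv B Y -> X = Y.
Proof.
move=> [BXB XBX BXh XBh] [BYB YBY BYh YBh].
have BXY : B *m X = B *m Y.
  rewrite -BXh -BYh -{1}BYB -[B *m Y *m B *m X]mulmxA adjmxM BXh BYh.
  by rewrite mulmxA BXB.
have XYB : X *m B = Y *m B.
  rewrite -XBh -YBh -{1}BYB -mulmxA mulmxA adjmxM XBh YBh.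
  by rewrite -mulmxA [B *m _]mulmxA BXB.
by rewrite -XBX XYB -mulmxA BXY mulmxA YBY.
Qed.

Lemma partial_isometryP (m n : nat) (B : 'M[C]_(m, n)) :
  partial_isometry B <-> B *m B^t* *m B = B.
Proof.
split=> [[BBB _ _ _]//|BBB].
split.
- exact: BBB.
- by rewrite -[in RHS]BBB !adjmxM trmxCK mulmxA.
- by rewrite adjmxM trmxCK.
- by rewrite adjmxM trmxCK.
Qed.

Section Square.
Variable n : nat.
Implicit Types A X : 'M[C]_n.

Definition is_core_EP A X : bool :=
  [&& X *m A *m X == X, eq_colspace X (A ^+ mxindex A)
    & eq_colspace (X^t*) (A ^+ mxindex A)].

Lemma gram_unit (r : nat) (P : 'M[C]_(n, r)) :
  row_full P -> P^t* *m P \in unitmx.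
Proof.
move=> Pfull; rewrite -row_free_unit -kermx_eq0; apply/eqP/row_matrixP => i.
set v := row i _; rewrite row0.
have vG : v *m (P^t* *m P) = 0.
  by apply/sub_kermxP; rewrite row_sub.
have w0 : v *m P^t* = 0.
  apply: contraTeq isT => /dotmx_is_dotmx.
  by rewrite dotmxE adjmxM trmxCK mulmxA -[v *m _ *m P]mulmxA vG mul0mx mxE ltxx.
have : P *m v^t* = 0 by rewrite -[P]trmxCK -adjmxM w0 trmx0 map_mx0.
move/(congr1 (mulmx (pinvmx P))).
rewrite mulmxA mulVpmx // mul1mx mulmx0 => /(congr1 (fun M => M^t*)).
by rewrite trmxCK trmx0 map_mx0.
Qed.

Lemma core_EP_exists A : exists X, is_core_EP A X.
Proof.
rewrite /is_core_EP; have := mxindexP A; move: (mxindex A) => k.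
set B := A ^+ k => rk.
have [r [P [R [PR Pfull Rfree rB]]]] : exists r (P : 'M[C]_(n, r))
    (R : 'M[C]_(r, n)), [/\ P *m R = B, row_full P, row_free R & \rank B = r].
  exists (\rank B), (col_base B), (row_base B).
  by split; rewrite ?mulmx_base ?col_base_full ?row_base_free.
have [R' RR'] : exists R', R *m R' = 1%:M.
  by exists (pinvmx R); rewrite mulmxVp.
pose T := R *m A *m R'.
have AP : A *m P = P *m T.
  have AB : A *m P *m R = P *m R *m A.
    by rewrite -mulmxA PR -[A *m B]exprS -[B *m A]exprSr.
  by rewrite /T !mulmxA -AB -[RHS]mulmxA RR' mulmx1.
have Tu : T \in unitmx.
  rewrite -row_full_unit; apply/eqP/anti_leq; rewrite rank_leq_col /=.
  rewrite -[X in (X <= _)%N]rB rk exprS -[A * _]/(A *m B) -PR mulmxA AP.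
  by rewrite (leq_trans (mxrankM_maxl _ _)) // mxrankM_maxr.
pose G := P^t* *m P; have Gu : G \in unitmx by exact: gram_unit.
pose X := P *m invmx T *m invmx G *m P^t*.
have PX : X *m P = P *m invmx T by rewrite -mulmxA mulmxKV.
have colP : (P^T == B^T)%MS.
  apply/andP; split; last by rewrite -PR trmx_mul submxMl.
  by rewrite -[P]mulmx1 -RR' mulmxA PR trmx_mul submxMl.
have eqBP (Y : 'M_n) (S : 'M_(r, n)) (S' : 'M_(n, r)) :
    Y = P *m S -> Y *m S' = P -> eq_colspace Y B.
  move=> YE YS; rewrite /eq_colspace; case/andP: colP => PB BP.
  apply/andP; split.
    by apply: submx_trans PB; rewrite YE trmx_mul submxMl.
  by apply: (submx_trans BP); rewrite -YS trmx_mul submxMl.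
exists X; apply/and3P; split.
- apply/eqP; rewrite {2}/X !mulmxA.
  rewrite -[X *m A *m P]mulmxA AP mulmxA PX.
  by rewrite mulmxKV // /X.
- apply: (eqBP _ (invmx T *m invmx G *m P^t*) (P *m T)).
    by rewrite /X !mulmxA.
  by rewrite mulmxA PX mulmxKV.
- have XE : X^t* = P *m (invmx T *m invmx G)^t* *m P^t*.
    by rewrite /X -[_ *m _ *m invmx G]mulmxA !adjmxM trmxCK !mulmxA.
  have Su : (invmx T *m invmx G)^t* \in unitmx.
    by rewrite map_unitmx unitmx_tr unitmx_mul !unitmx_inv Tu.
  move: ((invmx T *m invmx G)^t*) Su XE => S Su XE.
  apply: (eqBP _ (S *m P^t*) (P *m invmx G *m invmx S)).
    by rewrite XE mulmxA.
  by rewrite XE !mulmxA -[_ *m P^t* *m P]mulmxA mulmxK // mulmxK.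
Qed.

Lemma core_EP_unique A X Y : is_core_EP A X -> is_core_EP A Y -> X = Y.
Proof.
move=> /and3P[/eqP XAX /andP[XB BX] /andP[Xh hX]].
move=> /and3P[/eqP YAY /andP[YB BY] /andP[Yh hY]].
have /submxP[Z YE] := submx_trans YB BX.
have /submxP[W XE] := submx_trans Xh hY.
have XAY : X *m A *m Y = Y.
  by rewrite -[Y]trmxK YE trmx_mul trmxK mulmxA XAX.
move: XE => /(congr1 (fun M => M^T^t* )).
rewrite trmxK trmx_mul trmxK adjmxM !trmxCK.
move: (W^T^t* ) => {}W XE.
by rewrite -[RHS]XAY XE -!mulmxA [Y *m _]mulmxA YAY.
Qed.

Definition core_EP A : 'M[C]_n := xchoose (core_EP_exists A).

Lemma core_EPP A : is_core_EP A (core_EP A).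
Proof. exact: xchooseP. Qed.

End Square.
End CoreEP.

(* Main.v *)
(** The core EP inverse is [A^k (A^(k+1))^+], where [+] is the Moore-Penrose
    inverse. If [B = A^k] and [D = A^(k+1)] are partial isometries it is
    therefore [X = B D^*]. As [D^* D] is the orthogonal projector onto the
    common row space of [D] and [B], we have [B D^* D = B], hence
    [X X^* X = (B D^* D) B^* B D^* = (B B^* B) D^* = X]. *)
Require Import Defs.
From mathcomp Require Import all_boot all_order all_algebra.
From mathcomp Require Import complex reals.
Import GRing.Theory.
Local Open Scope ring_scope.
Local Open Scope complex_scope.
Local Open Scope sesquilinear_scope.

(** With [k = mxindex A], the rows of [A ^+ k.+1] lie in the row space of [A ^+ k]; equal ranks
    force the two row spaces to coincide. *)
Lemma expmx_index_factor {F : fieldType} {n : nat} (A : 'M[F]_n) :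
  exists U, A ^+ mxindex A = U *m A ^+ (mxindex A).+1.
Proof.
apply/submxP.
have sub : (A ^+ (mxindex A).+1 <= A ^+ mxindex A)%MS by rewrite exprS submxMl.
by rewrite -(geq_leqif (mxrank_leqif_sup sub)) mxindexP.
Qed.

(** Right multiplication by [Y *m A ^+ k.+1] fixes the row space of [A ^+ k.+1], hence the rows of
    [A ^+ k]. *)
Lemma expmx_index_mpinvK {C : numClosedFieldType} {n : nat} {A Y : 'M[C]_n} :
  is_mpinv (A ^+ (mxindex A).+1) Y ->
  A ^+ mxindex A *m Y *m A ^+ (mxindex A).+1 = A ^+ mxindex A.
Proof.
move=> [DYD _ _ _]; have [U BE] := expmx_index_factor A.
by rewrite [in LHS]BE -!mulmxA [_ *m (Y *m _)]mulmxA DYD -BE.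
Qed.

Lemma core_EP_mpinv {C : numClosedFieldType} {n : nat} {A Y : 'M[C]_n} :
  is_mpinv (A ^+ (mxindex A).+1) Y -> core_EP A = A ^+ mxindex A *m Y.
Proof.
move=> Ymp; apply: core_EP_unique (core_EPP A) _.
have BYD := expmx_index_mpinvK Ymp; case: Ymp => _ YDY DYh _.
rewrite /is_core_EP /eq_colspace.
have AB : A *m A ^+ mxindex A = A ^+ (mxindex A).+1 by rewrite exprS.
have BA : A ^+ mxindex A *m A = A ^+ (mxindex A).+1 by rewrite exprSr.
move: (A ^+ mxindex A) (A ^+ (mxindex A).+1) AB BA BYD YDY DYh.
move=> B D AB BA BYD YDY DYh.
have BX : (B^T <= (B *m Y)^T)%MS.
  by rewrite -[in X in (X <= _)%MS]BYD trmx_mul submxMl.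
have XB : ((B *m Y)^T <= B^T)%MS by rewrite trmx_mul submxMl.
have rkX : \rank (B *m Y) = \rank B.
  by apply/eqP; rewrite -mxrank_tr -(mxrank_tr B) eqn_leq !mxrankS.
(* [D *m Y] is Hermitian and [D = B *m A], so the adjoint of [Y = Y *m (D *m Y)] has [B] as left
   factor. *)
have XhE : (B *m Y)^t* = B *m (A *m Y *m Y^t* *m B^t* ).
  by rewrite adjmxM -[in LHS]YDY -mulmxA adjmxM DYh -BA !mulmxA.
have XhB : (((B *m Y)^t* )^T <= B^T)%MS by rewrite XhE trmx_mul submxMl.
apply/and3P; split; last 1 first.
(* The adjoint has the rank of [B *m Y], which is that of [B], so the inclusion [XhB] is an
   equality. *)
- rewrite -(geq_leqif (mxrank_leqif_eq XhB)).
  by rewrite !mxrank_tr mxrank_map mxrank_tr rkX.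
- by apply/eqP; rewrite -!mulmxA [A *m _]mulmxA AB [Y *m _]mulmxA YDY.
- by rewrite XB.
Qed.

Theorem theorem4p6 (R : realType) (n : nat) (A : 'M[R[i]]_n) :
  partial_isometry (A ^+ mxindex A) ->
  partial_isometry (A ^+ (mxindex A).+1) ->
  partial_isometry (core_EP A).
Proof.
move=> /partial_isometryP BBB Dpi.
rewrite (core_EP_mpinv Dpi); apply/partial_isometryP.
by rewrite adjmxM trmxCK !mulmxA expmx_index_mpinvK // BBB.
Qed.
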